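(* Let $\alpha\ge 0$ and let $f\in\Sigma$, $f(z)=z^{-1}+\sum_{n=0}^{\infty}a_nz^n$. If $$\sum_{n=0}^{\infty}\left[1+\alpha(n+1)\right]|a_n|\le 1,$$ then $f\in ME(\alpha)$.
   Context: Let $E=\{z\in\mathbb{C}: 0<|z|<1\}$. Let $\Sigma$ be the family of functions $f(z)=z^{-1}+\sum_{n=0}^{\infty}a_nz^n$ ($a_n\in\mathbb{C}$) that are analytic in $E$, with a simple pole at $z=0$. For $0\le\alpha$, $ME(\alpha)$ is the set of $f\in\Sigma$ such that $\operatorname{Re}(zf(z))>\alpha\,|z^2f'(z)+zf(z)|$ for all $z\in E$. *)

(* Defs.v *)
From Stdlib Require Import Reals.
From Coquelicot Require Import Coquelicot.
Open Scope R_scope.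

Definition in_E (z : C) : Prop := 0 < Cmod z < 1.

(** Complex (not real) differentiability at [z]: the scalar field is [C]. *)
Definition C_differentiable (f : C -> C) (z : C) : Prop :=
  @ex_derive C_AbsRing C_NormedModule f z.

(** [f(z) = z^-1 + sum_(n >= 0) a_n z^n] on [E], with [f] analytic in [E].
    Functions are total; their values outside [E] are irrelevant.  The
    expansion already makes [0] a simple pole (of residue [1]). *)
Definition Sigma_expansion (f : C -> C) (a : nat -> C) : Prop :=
  (forall z : C, in_E z -> C_differentiable f z) /\
  (forall z : C, in_E z ->
     @is_pseries C_AbsRing C_NormedModule a z (f z - / z)%C).

Definition Sigma (f : C -> C) : Prop :=
  exists a : nat -> C, Sigma_expansion f a.

(** For [f] in [Sigma], [C_derive f z] is the genuine complex derivative at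
    every [z] in [E], by [C_derive_correct]. *)
Definition ME (alpha : R) (f : C -> C) : Prop :=
  Sigma f /\
  forall z : C, in_E z ->
    Re (z * f z)%C > alpha * Cmod (z ^ 2 * C_derive f z + z * f z)%C.

(* Main.v *)
(** Write [F z = z f(z) = 1 + sum_n a_n z^(n+1)].  Then [z^2 f' + z f = z F'],
    and [F] is Lipschitz on [E] with constant [sum_n (n+1) |a_n|], so [|F'|] is
    at most this constant and no termwise differentiation is needed.  Hence, for
    [|z| = r < 1], both [|F z - 1|] and [alpha |z F' z|] are dominated by [r]
    times the corresponding parts of the coefficient sum, and
    [Re (F z) - alpha |z F' z| >= 1 - r > 0]. *)
Require Import Defs.
From Stdlib Require Import Reals Lra.
From Coquelicot Require Import Coquelicot.
Open Scope R_scope.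

(** The triangle inequality gives the bound for partial sums, and it passes to the limit because the
    norm is continuous. *)
Lemma is_series_norm_le {K : AbsRing} {V : NormedModule K}
  (u : nat -> V) (b : nat -> R) (l : V) (B : R) :
  is_series u l -> is_series b B -> (forall n, norm (u n) <= b n) -> norm l <= B.
Proof.
  intros Hu Hb Hle.
  apply (filterlim_le (F := eventually) (fun n => norm (sum_n u n)) (sum_n b)
           (Finite (norm l)) (Finite B)).
  - exists 0%nat; intros n _.
    eapply Rle_trans; [apply norm_sum_n_m | apply sum_n_m_le, Hle].
  - exact (filterlim_comp _ _ _ _ _ _ _ _ Hu (filterlim_norm l)).
  - exact Hb.
Qed.

Lemma Cmod_pow_le_1 (z : C) (n : nat) : Cmod z <= 1 -> Cmod (z ^ n) <= 1.
Proof.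
  intros Hz; rewrite Cmod_pow, <- (pow1 n).
  apply pow_incr; split; [apply Cmod_ge_0 | exact Hz].
Qed.

(** Induction on [n] through [w^(n+1) - z^(n+1) = w (w^n - z^n) + z^n (w - z)], where [w] and [z^n]
    have modulus at most 1. *)
Lemma Cmod_pow_sub_le (w z : C) (n : nat) :
  Cmod w <= 1 -> Cmod z <= 1 ->
  Cmod (w ^ n - z ^ n)%C <= INR n * Cmod (w - z)%C.
Proof.
  intros Hw Hz; induction n as [|n IH].
  - replace (w ^ 0 - z ^ 0)%C with (RtoC 0) by (simpl; ring).
    rewrite Cmod_0; simpl; lra.
  - replace (w ^ S n - z ^ S n)%C with (w * (w ^ n - z ^ n) + z ^ n * (w - z))%C
      by (simpl; ring).
    eapply Rle_trans; [apply Cmod_triangle|].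
    rewrite !Cmod_mult, S_INR.
    pose proof (Cmod_pow_le_1 z n Hz).
    pose proof (Cmod_ge_0 w); pose proof (Cmod_ge_0 (w - z)%C).
    pose proof (Cmod_ge_0 (w ^ n - z ^ n)%C).
    assert (Cmod w * Cmod (w ^ n - z ^ n)%C <= 1 * Cmod (w ^ n - z ^ n)%C)
      by (apply Rmult_le_compat_r; assumption).
    assert (Cmod (z ^ n)%C * Cmod (w - z)%C <= 1 * Cmod (w - z)%C)
      by (apply Rmult_le_compat_r; assumption).
    lra.
Qed.

(* The two module structures on [C] have the same norm but different, and not
   convertible, uniform structures on the codomain. *)
Lemma is_derive_C_AbsRing (f : C -> C) (z l : C) :
  @is_derive C_AbsRing C_NormedModule f z l ->
  @is_derive C_AbsRing (AbsRing_NormedModule C_AbsRing) f z l.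
Proof.
  intros [_ Hd]; split; [apply is_linear_scal_l | exact Hd].
Qed.

(** A difference quotient at a small displacement has modulus at most [L] and lies within [eps] of
    [l], so [Cmod l <= L + eps] for every [eps > 0]. *)
Lemma Cmod_derive_le (F : C -> C) (z l : C) (L : R) (d : posreal) :
  @is_derive C_AbsRing (AbsRing_NormedModule C_AbsRing) F z l ->
  (forall w, Cmod (w - z)%C < d -> Cmod (F w - F z)%C <= L * Cmod (w - z)%C) ->
  Cmod l <= L.
Proof.
  intros [_ Hd] Hlip.
  apply Rle_plus_epsilon; intros eps Heps.
  destruct (Hd z (fun P HP => HP) (mkposreal eps Heps)) as [e He].
  (* A real displacement [t] small enough for both the Lipschitz bound (radius [d]) and the
     derivative estimate (radius [e]). *)
  set (t := Rmin d e / 2).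
  assert (Ht : 0 < t < d /\ t < e).
  { unfold t; pose proof (cond_pos d); pose proof (cond_pos e).
    unfold Rmin; destruct (Rle_dec d e); lra. }
  destruct Ht as [[Ht0 Htd] Hte].
  assert (Hmod : Cmod ((z + t) - z)%C = t).
  { replace ((z + t) - z)%C with (RtoC t) by ring.
    rewrite Cmod_R; apply Rabs_pos_eq; lra. }
  specialize (Hlip (z + t)%C); rewrite Hmod in Hlip; specialize (Hlip Htd).
  assert (Hball : Cmod ((z + t) - z)%C < e) by (rewrite Hmod; exact Hte).
  specialize (He (z + t)%C Hball).
  change (Cmod ((F (z + t)%C - F z) - ((z + t) - z) * l)%C
            <= eps * Cmod ((z + t) - z)%C) in He.
  rewrite Hmod in He.
  assert (Htri : t * Cmod l <= L * t + eps * t).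
  { rewrite <- Hmod at 1; rewrite <- Cmod_mult.
    replace (((z + t) - z) * l)%C with
      ((F (z + t) - F z) + - ((F (z + t) - F z) - ((z + t) - z) * l))%C by ring.
    eapply Rle_trans; [apply Cmod_triangle|].
    rewrite Cmod_opp; lra. }
  apply (Rmult_le_reg_l t); lra.
Qed.

(** The radius is the distance from [z] to the boundary of [E], which consists of 0 and the unit
    circle. *)
Lemma in_E_ball (z w : C) :
  in_E z -> Cmod (w - z)%C < Rmin (Cmod z) (1 - Cmod z) -> in_E w.
Proof.
  intros [Hz0 Hz1] Hw; unfold in_E.
  pose proof (Rmin_l (Cmod z) (1 - Cmod z)).
  pose proof (Rmin_r (Cmod z) (1 - Cmod z)).
  pose proof (Cmod_triangle (w - z) z) as H1.
  pose proof (Cmod_triangle w (- (w - z))) as H2.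
  replace (w - z + z)%C with w in H1 by ring.
  replace (w + - (w - z))%C with z in H2 by ring.
  rewrite Cmod_opp in H2; lra.
Qed.

Lemma in_E_neq_0 (z : C) : in_E z -> z <> RtoC 0.
Proof. intros [Hz _] ->; rewrite Cmod_0 in Hz; lra. Qed.

Lemma pow_n_Cpow (z : C) (n : nat) : @pow_n C_Ring z n = (z ^ n)%C.
Proof. induction n as [|n IH]; [reflexivity | simpl; now rewrite IH]. Qed.

(** Multiplying the expansion by [z] raises each exponent by one and turns the polar part into the
    constant 1. *)
Lemma Sigma_is_series (f : C -> C) (a : nat -> C) (z : C) :
  Sigma_expansion f a -> in_E z ->
  @is_series C_AbsRing C_NormedModule (fun n => a n * z ^ S n)%C (z * f z - 1)%C.
Proof.
  intros hf Hz.
  pose proof (is_series_scal z _ _ (proj2 hf z Hz)) as Hs.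
  replace (z * f z - 1)%C with (scal z (f z - / z)%C : C).
  - eapply is_series_ext; [|exact Hs].
    intros n; cbv beta; rewrite pow_n_Cpow.
    change (z * (z ^ n * a n) = a n * (z * z ^ n))%C; ring.
  - change (z * (f z - / z) = z * f z - 1)%C.
    field; exact (in_E_neq_0 z Hz).
Qed.

(** One factor [Cmod z] of each [z^(n+1)] is kept; the remaining power is bounded by 1. *)
Lemma Sigma_Cmod_sub_1_le (f : C -> C) (a : nat -> C) (z : C) (B : R) :
  Sigma_expansion f a -> in_E z ->
  is_series (fun n => Cmod (a n)) B -> Cmod (z * f z - 1)%C <= Cmod z * B.
Proof.
  intros hf Hz HB.
  apply (is_series_norm_le _ _ _ _ (Sigma_is_series f a z hf Hz)
           (is_series_scal (Cmod z) _ _ HB)).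
  intros n; change (Cmod (a n * (z * z ^ n))%C <= Cmod z * Cmod (a n)).
  rewrite !Cmod_mult.
  pose proof (Cmod_pow_le_1 z n (Rlt_le _ _ (proj2 Hz))).
  pose proof (Cmod_ge_0 z); pose proof (Cmod_ge_0 (a n)).
  replace (Cmod z * Cmod (a n)) with (Cmod (a n) * (Cmod z * 1)) by ring.
  repeat apply Rmult_le_compat_l; assumption.
Qed.

(** The constant terms cancel in the difference of the two series, and the power estimate at
    exponent [n+1] supplies the weight [n+1]. *)
Lemma Sigma_lipschitz (f : C -> C) (a : nat -> C) (w z : C) (L : R) :
  Sigma_expansion f a -> in_E w -> in_E z ->
  is_series (fun n => (INR n + 1) * Cmod (a n)) L ->
  Cmod (w * f w - z * f z)%C <= L * Cmod (w - z)%C.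
Proof.
  intros hf Hw Hz HL.
  pose proof (is_series_minus _ _ _ _ (Sigma_is_series f a w hf Hw) (Sigma_is_series f a z hf Hz))
    as Hs.
  replace (w * f w - z * f z)%C with
    (plus (w * f w - 1)%C (opp (z * f z - 1)%C) : C)
    by (change ((w * f w - 1) + - (z * f z - 1) = w * f w - z * f z)%C; ring).
  rewrite (Rmult_comm L).
  apply (is_series_norm_le _ _ _ _ Hs (is_series_scal (Cmod (w - z)%C) _ _ HL)).
  intros n.
  change (Cmod (a n * w ^ S n + - (a n * z ^ S n))%C
            <= Cmod (w - z)%C * ((INR n + 1) * Cmod (a n))).
  replace (a n * w ^ S n + - (a n * z ^ S n))%C with
    (a n * (w ^ S n - z ^ S n))%C by ring.
  rewrite Cmod_mult.
  replace (Cmod (w - z)%C * ((INR n + 1) * Cmod (a n))) with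
    (Cmod (a n) * (INR (S n) * Cmod (w - z)%C)) by (rewrite S_INR; ring).
  apply Rmult_le_compat_l; [apply Cmod_ge_0|].
  apply Cmod_pow_sub_le; apply Rlt_le; [apply Hw | apply Hz].
Qed.

Lemma Sigma_Cmod_derive_le (f : C -> C) (a : nat -> C) (z : C) (L : R) :
  Sigma_expansion f a -> in_E z ->
  is_series (fun n => (INR n + 1) * Cmod (a n)) L ->
  Cmod (z ^ 2 * C_derive f z + z * f z)%C <= Cmod z * L.
Proof.
  intros hf Hz HL.
  pose proof (is_derive_C_AbsRing _ _ _ (C_derive_correct f z z (proj1 hf z Hz)))
    as Hd.
  (* The product rule gives [F' z = f z + z f' z], which is the target expression divided by [z]. *)
  pose proof (@is_derive_mult C_AbsRing (fun w => w) f z one (C_derive f z)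
                (is_derive_id z) Hd Cmult_comm) as Hm.
  assert (Hr : 0 < Rmin (Cmod z) (1 - Cmod z))
    by (apply Rmin_pos; unfold in_E in Hz; lra).
  replace (z ^ 2 * C_derive f z + z * f z)%C
    with (z * (1 * f z + z * C_derive f z))%C by (simpl; ring).
  rewrite Cmod_mult; apply Rmult_le_compat_l; [apply Cmod_ge_0|].
  apply (Cmod_derive_le _ z _ L (mkposreal _ Hr) Hm).
  intros w Hw.
  exact (Sigma_lipschitz f a w z L hf (in_E_ball z w Hz Hw) Hz HL).
Qed.

Theorem theorem2p2 (alpha : R) (f : C -> C) (a : nat -> C)
  (halpha : 0 <= alpha)
  (hf : Sigma_expansion f a)
  (hconv : ex_series (fun n : nat => (1 + alpha * (INR n + 1)) * Cmod (a n)))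
  (hsum : Series (fun n : nat => (1 + alpha * (INR n + 1)) * Cmod (a n)) <= 1) :
  ME alpha f.
Proof.
  split; [exists a; exact hf|].
  intros z Hz.
  set (T := Series (fun n => (1 + alpha * (INR n + 1)) * Cmod (a n))) in hsum.
  assert (HT : is_series (fun n => (1 + alpha * (INR n + 1)) * Cmod (a n)) T)
    by exact (Series_correct _ hconv).
  (* Comparison with [hconv]: each weight [1 + alpha (n+1)] is at least 1. *)
  assert (HA : ex_series (fun n => Cmod (a n))).
  { apply (ex_series_le (K := R_AbsRing) (V := R_CompleteNormedModule) _ _)
      with (2 := hconv).
    intros n; change (Rabs (Cmod (a n)) <= (1 + alpha * (INR n + 1)) * Cmod (a n)).
    rewrite Rabs_pos_eq by apply Cmod_ge_0.
    pose proof (Rmult_le_pos _ _ (Rmult_le_pos alpha (INR n + 1) halpha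
      ltac:(pose proof (pos_INR n); lra)) (Cmod_ge_0 (a n))).
    lra. }
  set (S0 := Series (fun n => Cmod (a n))).
  assert (HS0 : is_series (fun n => Cmod (a n)) S0) by exact (Series_correct _ HA).
  assert (Hone : Cmod (z * f z - 1)%C <= Cmod z * S0)
    by exact (Sigma_Cmod_sub_1_le f a z S0 hf Hz HS0).
  assert (Hder : alpha * Cmod (z ^ 2 * C_derive f z + z * f z)%C
                   <= Cmod z * (T - S0)).
  { assert (Hdiff : is_series (fun n => alpha * ((INR n + 1) * Cmod (a n))) (T - S0)).
    { eapply is_series_ext; [|exact (is_series_minus _ _ _ _ HT HS0)].
      intros n; change ((1 + alpha * (INR n + 1)) * Cmod (a n) + - Cmod (a n)
        = alpha * ((INR n + 1) * Cmod (a n))); ring. }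
    (* For [alpha = 0] the series of [(n+1) |a_n|] may diverge. *)
    destruct (Req_dec alpha 0) as [H0|H0].
    - assert (H : 0 <= T - S0).
      { apply Rle_trans with (norm (T - S0)); [apply norm_ge_0|].
        (* All terms vanish here, so the series is its own majorant; this yields
           [norm (T - S0) <= T - S0]. *)
        apply (is_series_norm_le _ _ _ _ Hdiff Hdiff).
        intros n; rewrite H0, Rmult_0_l.
        change (Rabs 0 <= 0); rewrite Rabs_R0; lra. }
      rewrite H0, Rmult_0_l.
      apply Rmult_le_pos; [apply Cmod_ge_0 | exact H].
    - assert (HL : is_series (fun n => (INR n + 1) * Cmod (a n)) (/ alpha * (T - S0))).
      { eapply is_series_ext; [|exact (is_series_scal (/ alpha) _ _ Hdiff)].
        intros n; change (/ alpha * (alpha * ((INR n + 1) * Cmod (a n)))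
          = (INR n + 1) * Cmod (a n)); field; exact H0. }
      replace (Cmod z * (T - S0)) with (alpha * (Cmod z * (/ alpha * (T - S0))))
        by (field; exact H0).
      apply Rmult_le_compat_l; [exact halpha|].
      exact (Sigma_Cmod_derive_le f a z _ hf Hz HL). }
  assert (HRe : 1 - Cmod (z * f z - 1)%C <= Re (z * f z)%C).
  { pose proof (re_le_Cmod (z * f z - 1)%C) as H.
    replace (Re (z * f z - 1)%C) with (Re (z * f z)%C - 1) in H
      by (unfold Re; simpl; ring).
    pose proof (Rle_abs (- (Re (z * f z)%C - 1))) as H'.
    rewrite Rabs_Ropp in H'; lra. }
  (* In the sum of [Hone] and [Hder] the terms in [S0] cancel, leaving [Cmod z * T], which is at
     most [Cmod z < 1]. *)
  assert (HzT : Cmod z * T <= Cmod z * 1)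
    by (apply Rmult_le_compat_l; [apply Cmod_ge_0 | exact hsum]).
  destruct Hz as [_ Hz1].
  lra.
Qed.
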